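(* Let $d>1$ and let $K$ be a proper convex cone in $\mathbb R^d$. Then $$\mathcal F^K_{\mathrm{cconv}}(\mathbb R^d)=\{x^*\in\mathcal F_{\mathrm{cconv}}(\mathbb R^d):\operatorname{supp}\xi_{x^*}\subset K\}$$ is a proper convex cone in $\mathcal F_{\mathrm{cconv}}(\mathbb R^d)$.
   Context: Fuzzy vectors. A $d$-dimensional fuzzy vector $x^*$ is identified with its characterizing function $\xi_{x^*}:\mathbb R^d\to[0,1]$, which is required to satisfy: (1) $\operatorname{supp}\xi_{x^*}:=\overline{\{x\in\mathbb R^d:\xi_{x^*}(x)>0\}}$ is bounded; (2) for every $\alpha\in(0,1]$ the $\alpha$-cut $C_\alpha(x^* )=\{x\in\mathbb R^d:\xi_{x^*}(x)\ge\alpha\}$ is non-empty, compact and convex, and so is $C_0(x^* ):=\operatorname{supp}\xi_{x^*}$. The set of all such fuzzy vectors is $\mathcal F_{\mathrm{cconv}}(\mathbb R^d)$. Arithmetic. The sum $x^*\oplus y^*$ and the scalar multiple $\lambda\odot x^*$ ($\lambda\in\mathbb R$) are the fuzzy vectors defined via $\alpha$-cuts by $C_\alpha(x^*\oplus y^* )=C_\alpha(x^* )+C_\alpha(y^* )$ (Minkowski sum) and $C_\alpha(\lambda\odot x^* )=\lambda\cdot C_\alpha(x^* )=\{\lambda a:a\in C_\alpha(x^* )\}$. We write $-x^*:=(-1)\odot x^*$, and $0$ denotes the fuzzy vector whose characterizing function is the indicator function of $\{0\}\subset\mathbb R^d$. Cones. In $\mathbb R^d$, or in $\mathcal F_{\mathrm{cconv}}(\mathbb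 R^d)$ with the operations $\oplus,\odot$, a subset is a convex cone if it is closed under addition and under multiplication by real scalars $\lambda>0$. A convex cone $\mathcal C$ is called proper if $x\in\mathcal C$ and $-x\in\mathcal C$ imply $x=0$. *)

(* Defs.v *)
From mathcomp Require Import all_boot all_order all_algebra.
From mathcomp Require Import interval_inference.
From mathcomp Require Import boolp classical_sets functions reals topology.
From mathcomp Require Import normedtype convex numfun.

Set Implicit Arguments.
Unset Strict Implicit.
Unset Printing Implicit Defensive.

Import Order.TTheory GRing.Theory Num.Theory.
Import numFieldNormedType.Exports.

Local Open Scope classical_set_scope.
Local Open Scope ring_scope.

Section convex_cones.
Variables (R : numDomainType) (T : Type).
Variables (add : T -> T -> T) (scale : R -> T -> T) (opp : T -> T) (zero : T).

Definition convex_cone (C : set T) : Prop :=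
  (forall x y, C x -> C y -> C (add x y)) /\
  (forall (l : R) x, 0 < l -> C x -> C (scale l x)).

Definition proper_convex_cone (C : set T) : Prop :=
  convex_cone C /\ (forall x, C x -> C (opp x) -> x = zero).

End convex_cones.

Section fuzzy_vectors.
Variables (R : realType) (d : nat).
Local Notation V := 'rV[R]_d.

Definition supp (xi : V -> R) : set V := closure [set x | 0 < xi x].

(* Only meaningful for a in [0, 1]; the case a = 0 is the support. *)
Definition cut (xi : V -> R) (a : R) : set V :=
  if a == 0 then supp xi else [set x | a <= xi x].

Definition is_fuzzy_vector (xi : V -> R) : Prop :=
  [/\ forall x, 0 <= xi x <= 1,
      bounded_set (supp xi) &
      forall a, 0 <= a <= 1 ->
        [/\ cut xi a !=set0, compact (cut xi a) & convex_set (cut xi a)]].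

Record fuzzy_vector := FuzzyVector {
  charfun :> V -> R ;
  charfunP : is_fuzzy_vector charfun }.

Lemma fuzzy_vector_eq (x y : fuzzy_vector) : charfun x = charfun y -> x = y.
Proof.
case: x y => [f fP] [g gP] /= fg; case: _ / fg gP => gP.
by rewrite (Prop_irrelevance fP gP).
Qed.

Lemma cut0 (xi : V -> R) : cut xi 0 = supp xi.
Proof. by rewrite /cut eqxx. Qed.

Lemma cut_gt0 (xi : V -> R) (a : R) : 0 < a -> cut xi a = [set x | a <= xi x].
Proof. by rewrite /cut => /gt_eqF ->. Qed.

Lemma fuzzy_cut_inj (x y : fuzzy_vector) :
  (forall a, 0 <= a <= 1 -> cut x a = cut y a) -> x = y.
Proof.
move=> xy; apply/fuzzy_vector_eq/funext => v.
have [x01 _ _] := charfunP x; have [y01 _ _] := charfunP y.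
have /andP[x0 x1] := x01 v; have /andP[y0 y1] := y01 v.
apply/eqP; rewrite eq_le; apply/andP; split.
- have [->//|xN0] := eqVneq (charfun x v) 0.
  have xgt : 0 < charfun x v by rewrite lt_neqAle eq_sym xN0.
  have := xy (charfun x v); rewrite !cut_gt0// => /(_ (x01 v)) E.
  by have : [set u | charfun x v <= charfun y u] v by rewrite -E /=.
- have [->//|yN0] := eqVneq (charfun y v) 0.
  have ygt : 0 < charfun y v by rewrite lt_neqAle eq_sym yN0.
  have := xy (charfun y v); rewrite !cut_gt0// => /(_ (y01 v)) E.
  by have : [set u | charfun y v <= charfun x u] v by rewrite E /=.
Qed.

Lemma fuzzy_of_cuts (A : R -> set V) :
  (forall a, 0 <= a <= 1 -> [/\ A a !=set0, compact (A a) & convex_set (A a)]) ->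
  (forall a b, 0 < a -> a <= b -> b <= 1 -> A b `<=` A a) ->
  (forall a v, 0 < a -> a <= 1 -> (forall b, 0 < b -> b < a -> A b v) -> A a v) ->
  A 0 = closure [set v | exists2 a, 0 < a <= 1 & A a v] ->
  exists z : fuzzy_vector, forall a, 0 <= a <= 1 -> cut z a = A a.
Proof.
move=> Aok Amono Acap A0.
pose S v : set R := [set a | a = 0 \/ (0 < a <= 1 /\ A a v)].
pose xi v := sup (S v).
have S0 v : S v !=set0 by exists 0; left.
have Sub v : ubound (S v) 1 by move=> a [->//|[/andP[_ ?]]].
have Ssup v : has_sup (S v) by split; [exact: S0|exists 1; exact: Sub].
have xi01 v : 0 <= xi v <= 1.
  apply/andP; split; last exact: ge_sup.
  by apply: ub_le_sup; [exists 1; exact: Sub|left].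
have xiA a v : 0 < a -> a <= 1 -> (a <= xi v) <-> A a v.
  move=> a0 a1; split => [axi|Aav]; last first.
    apply: ub_le_sup; first by exists 1; exact: Sub.
    by right; rewrite a0 a1.
  apply: Acap => // b b0 ba.
  have : b < xi v by exact: lt_le_trans axi.
  move=> /(sup_gt (S0 v))[c [->|[/andP[c0 c1] Acv]] bc].
    by rewrite ltNge (ltW b0) in bc.
  exact: (Amono b c b0 (ltW bc) c1).
have cutxi a : 0 <= a <= 1 -> cut xi a = A a.
  move=> /andP[a0 a1]; have [->|aN0] := eqVneq a 0.
    rewrite cut0 A0; congr closure; apply/seteqP; split => v /=.
      move=> v0; have /andP[_ v1] := xi01 v.
      by exists (xi v); [rewrite v0|apply/(xiA _ _ v0 v1)].
    by move=> [b /andP[b0 b1] /(xiA _ _ b0 b1)]; exact: lt_le_trans.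
  have agt : 0 < a by rewrite lt_neqAle eq_sym aN0.
  by rewrite cut_gt0//; apply/seteqP; split => v /= /xiA; exact.
have xiP : is_fuzzy_vector xi.
  split => //.
  - rewrite -cut0 cutxi ?lexx ?ler01//.
    by apply: compact_bounded; have [] : _ := Aok 0 (introT andP (conj (lexx 0) ler01)).
  - by move=> a a01; rewrite cutxi//; exact: Aok.
by exists (FuzzyVector xiP).
Qed.

Lemma cut_mono (x : fuzzy_vector) (a b : R) :
  0 <= a -> a <= b -> b <= 1 -> cut x b `<=` cut x a.
Proof.
move=> a0 ab b1; have [->|aN0] := eqVneq a 0; last first.
  have agt : 0 < a by rewrite lt_neqAle eq_sym aN0.
  rewrite !cut_gt0 //; last exact: lt_le_trans ab.
  by move=> v /=; exact: le_trans.
have [->//|bN0] := eqVneq b 0.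
have bgt : 0 < b by rewrite lt_neqAle eq_sym bN0 (le_trans a0).
rewrite cut0 cut_gt0 // => v /= bv; apply: subset_closure => /=.
exact: lt_le_trans bv.
Qed.

Lemma cut_cap (x : fuzzy_vector) (a : R) v : 0 < a ->
  (forall b, 0 < b -> b < a -> cut x b v) -> cut x a v.
Proof.
move=> a0 H; rewrite cut_gt0//=; rewrite leNgt; apply/negP => xa.
have [x01 _ _] := charfunP x; have /andP[x0 _] := x01 v.
have [m1 m2] := midf_lt xa.
have m0 : 0 < (charfun x v + a) / 2 by exact: le_lt_trans m1.
by have := H _ m0 m2; rewrite cut_gt0//= leNgt m1.
Qed.

Lemma cut_supp (x : fuzzy_vector) :
  cut x 0 = closure [set v | exists2 a, 0 < a <= 1 & cut x a v].
Proof.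
rewrite cut0; congr closure; apply/seteqP; split => v /=.
  have [/(_ v)/andP[_ x1] _ _] := charfunP x.
  by move=> x0; exists (charfun x v); [rewrite x0 x1|rewrite cut_gt0/=].
by move=> [a /andP[a0 _]]; rewrite cut_gt0//=; exact: lt_le_trans.
Qed.

(* The image of a compact, nested, left-continuous family of sets has the same
   properties. *)
Lemma image_cuts (T : topologicalType) (f : T -> V) (D : R -> set T) :
  hausdorff_space T -> continuous f ->
  (forall a, 0 <= a <= 1 -> compact (D a)) ->
  (forall a b, 0 <= a -> a <= b -> b <= 1 -> D b `<=` D a) ->
  (forall a t, 0 < a -> a <= 1 -> (forall b, 0 < b -> b < a -> D b t) -> D a t) ->
  D 0 `<=` closure [set t | exists2 a, 0 < a <= 1 & D a t] ->
  (forall a, 0 <= a <= 1 -> f @` D a !=set0 /\ convex_set (f @` D a)) ->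
  exists z : fuzzy_vector, forall a, 0 <= a <= 1 -> cut z a = f @` D a.
Proof.
move=> hT cf cD mD capD suppD ncD.
have fD a : 0 <= a <= 1 -> compact (f @` D a).
  move=> a01; apply: continuous_compact; last exact: cD.
  exact: continuous_subspaceT.
apply: fuzzy_of_cuts.
- by move=> a a01; have [? ?] := ncD _ a01; split => //; exact: fD.
- move=> a b a0 ab b1; apply: image_subset; apply: mD => //; exact: ltW.
- move=> a v a0 a1 H; apply: contrapT => nv.
  pose K := D (a / 2).
  have a20 : 0 < a / 2 by rewrite divr_gt0.
  have a2a : a / 2 < a by rewrite ltr_pdivrMr// mulr_natr mulr2n ltrDl.
  have /compact_near_coveringP cK : compact K.
    by apply: cD; rewrite ltW//= (le_trans (ltW a2a)).
  have near_disj : \forall b \near a^'-, K `<=` [set t | ~ (D b t /\ f t = v)].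
    apply: (cK R (a^'-) (fun b t => ~ (D b t /\ f t = v))).
    move=> t Kt.
    have [ftv|ftv] := eqVneq (f t) v.
      have [b b0 [ba nDb]] : exists2 b, 0 < b & b < a /\ ~ D b t.
        apply: contrapT => nE; apply: nv; exists t => //.
        apply: capD => // b b0 ba; apply: contrapT => nDb.
        by apply: nE; exists b.
      have cDb : closed (D b).
        apply: compact_closed => //; apply: cD.
        by rewrite ltW//= (le_trans (ltW ba)).
      exists (~` D b, [set c | b < c < a]).
        split => /=.
          by apply: open_nbhs_nbhs; split => //; exact: closed_openC.
        near=> c; apply/andP; split; near: c.
          exact: nbhs_left_gt.
        exact: nbhs_left_lt.
      move=> [t' c] /= [nDb' /andP[bc ca]] [Dct' _]; apply: nDb'.
      by apply: (mD b c) => //; [exact: ltW|exact: ltW|exact: ltW (lt_le_trans ca a1)].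
    exists (f @^-1` (~` [set v]), setT).
      split => /=; last exact: filterT.
      apply: cf; apply: open_nbhs_nbhs; split; last by apply/eqP.
      apply: closed_openC; apply: compact_closed; last exact: compact_set1.
      exact: norm_hausdorff.
    by move=> [t' c] /= [nft _] [_ ?]; exact: nft.
  have [b [[/= ab ba] nKb]] : exists b, (a / 2 < b /\ b < a) /\
      K `<=` [set t | ~ (D b t /\ f t = v)].
    near (a^'-) => b; exists b; split; last by near: b.
    by split; near: b; [exact: nbhs_left_gt|exact: nbhs_left_lt].
  have b0 : 0 < b by exact: lt_trans ab.
  have [t Dbt ftv] := H b b0 ba.
  apply: (nKb t) => //; apply: (mD _ b) => //; first exact: ltW.
    exact: ltW.
  exact: ltW (lt_le_trans ba a1).
- apply/seteqP; split.
  + move=> _ [t D0t <-] U /cf fU.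
    have [t' [[b b01 Dbt'] Ut']] := suppD _ D0t _ fU.
    by exists (f t'); split => //; exists b => //; exists t'.
  + have c0 : closed (f @` D 0).
      by apply: compact_closed; [exact: norm_hausdorff|apply: fD; rewrite lexx ler01].
    rewrite [X in _ `<=` X](closure_id _).1//; apply: closureS.
    move=> w [b /andP[b0 b1] [t Dbt <-]]; exists t => //.
    by apply: (mD 0 b) => //; exact: ltW.
Unshelve. all: by end_near. Qed.

Lemma fuzzy_add_ex (x y : fuzzy_vector) : exists z : fuzzy_vector,
  forall a, 0 <= a <= 1 -> cut z a = [set u + v | u in cut x a & v in cut y a].
Proof.
have [_ _ xP] := charfunP x; have [_ _ yP] := charfunP y.
pose f (p : V * V) := p.1 + p.2; pose D a := cut x a `*` cut y a.
have fD a : f @` D a = [set u + v | u in cut x a & v in cut y a].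
  apply/seteqP; split => w /=.
    by move=> [[u v] [/= xu yv] <-]; exists u => //; exists v.
  by move=> [u xu [v yv <-]]; exists (u, v).
have [z zP] : exists z : fuzzy_vector, forall a, 0 <= a <= 1 -> cut z a = f @` D a.
  apply: image_cuts.
  - exact: norm_hausdorff.
  - exact: add_continuous.
  - by move=> a a01; apply: compact_setX; [case: (xP a a01)|case: (yP a a01)].
  - by move=> a b a0 ab b1 [u v] [/= ? ?]; split => /=; exact: (cut_mono a0 ab b1).
  - move=> a [u v] a0 a1 H; split => /=; apply: cut_cap => // b b0 ba;
      by have [] := H b b0 ba.
  - move=> [u v]; rewrite /D !cut_supp => -[/= xu yv] U [[P Q] /= [Pu Qv] PQU].
    have [u' [[b /andP[b0 b1] bu] Pu1]] := xu _ Pu.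
    have [v' [[c /andP[c0 c1] cv] Qv1]] := yv _ Qv.
    exists (u', v'); split; last exact: PQU.
    have m0 : 0 < Num.min b c by rewrite lt_min b0.
    exists (Num.min b c); first by rewrite m0 ge_min b1.
    by split => /=; [apply: (cut_mono (ltW m0) _ b1) bu|apply: (cut_mono (ltW m0) _ c1) cv];
      rewrite ge_min lexx ?orbT.
  - move=> a a01; have [[u xu] _ cx] := xP a a01; have [[v yv] _ cy] := yP a a01.
    split; first by exists (u + v); exists (u, v).
    move=> _ _ l /set_mem[[p q] [/= xp yq] <-] /set_mem[[p' q'] [/= xp' yq'] <-].
    apply/mem_set; exists ((l%:inum *: p + (1 - l%:inum) *: p'),
                           (l%:inum *: q + (1 - l%:inum) *: q')).
      split => /=; apply/set_mem.
        exact: (cx p p' l (mem_set xp) (mem_set xp')).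
      exact: (cy q q' l (mem_set yq) (mem_set yq')).
    rewrite /f/= /conv/= !scalerDr; exact: addrACA.
by exists z => a a01; rewrite zP.
Qed.

Lemma fuzzy_scale_ex (l : R) (x : fuzzy_vector) : exists z : fuzzy_vector,
  forall a, 0 <= a <= 1 -> cut z a = [set l *: u | u in cut x a].
Proof.
have [_ _ xP] := charfunP x.
apply: (@image_cuts V ( *:%R l) (cut x)).
- exact: norm_hausdorff.
- exact: scaler_continuous.
- by move=> a a01; case: (xP a a01).
- exact: cut_mono.
- by move=> a v a0 _; exact: cut_cap.
- by rewrite cut_supp.
- move=> a a01; have [[u xu] _ cx] := xP a a01.
  split; first by exists (l *: u); exists u.
  move=> _ _ k /set_mem[p xp <-] /set_mem[q xq <-].
  apply/mem_set; exists (k%:inum *: p + (1 - k%:inum) *: q).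
    by apply/set_mem; exact: (cx p q k (mem_set xp) (mem_set xq)).
  by rewrite /conv/= scalerDr !scalerA mulrC [l * _]mulrC.
Qed.

Lemma fuzzy_zeroP : is_fuzzy_vector (\1_[set 0]).
Proof.
have pos : [set x : V | 0 < (\1_[set 0] x : R)] = [set 0].
  apply/seteqP; split => v /=; rewrite indicE.
    by case: (boolP (v \in _)) => [/set_mem//|_]; rewrite ltxx.
  by move=> ->; rewrite mem_set// ltr01.
have cl0 : closed [set (0 : V)].
  by apply: compact_closed; [exact: norm_hausdorff|exact: compact_set1].
have supp0 : supp (\1_[set 0]) = [set 0] by rewrite /supp pos -(closure_id _).1.
have cuts a : 0 <= a <= 1 -> cut (\1_[set 0]) a = [set 0].
  move=> /andP[a0 a1]; have [->|aN0] := eqVneq a 0; first by rewrite cut0.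
  have agt : 0 < a by rewrite lt_neqAle eq_sym aN0.
  rewrite cut_gt0//; apply/seteqP; split => v /=.
    by move=> av; rewrite -[v = 0]/([set 0] v) -pos /=; exact: lt_le_trans av.
  by move=> ->; rewrite indicE mem_set.
split.
- by move=> v; rewrite indicE; case: (_ \in _); rewrite ?lexx ?ler01.
- by rewrite supp0; apply: compact_bounded; exact: compact_set1.
- move=> a a01; rewrite cuts//; split.
  + by exists 0.
  + exact: compact_set1.
  + move=> _ _ l /set_mem-> /set_mem->; apply/mem_set.
    by rewrite convmm.
Qed.

(* The chosen witness is unique by fuzzy_cut_inj. *)
Definition fuzzy_add (x y : fuzzy_vector) : fuzzy_vector :=
  sval (cid (fuzzy_add_ex x y)).

Definition fuzzy_scale (l : R) (x : fuzzy_vector) : fuzzy_vector :=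
  sval (cid (fuzzy_scale_ex l x)).

Definition fuzzy_opp (x : fuzzy_vector) : fuzzy_vector := fuzzy_scale (-1) x.

Definition fuzzy_zero : fuzzy_vector := FuzzyVector fuzzy_zeroP.

Lemma cut_fuzzy_add (x y : fuzzy_vector) (a : R) : 0 <= a <= 1 ->
  cut (fuzzy_add x y) a = [set u + v | u in cut x a & v in cut y a].
Proof. exact: (svalP (cid (fuzzy_add_ex x y))). Qed.

Lemma cut_fuzzy_scale (l : R) (x : fuzzy_vector) (a : R) : 0 <= a <= 1 ->
  cut (fuzzy_scale l x) a = [set l *: u | u in cut x a].
Proof. exact: (svalP (cid (fuzzy_scale_ex l x))). Qed.

Definition fuzzy_supp_in (K : set V) : set fuzzy_vector :=
  [set x | supp x `<=` K].

End fuzzy_vectors.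

Arguments fuzzy_zero {R d}.

(* Main.v *)
(** Each of the two arithmetic operations acts on supports as on the other
    cuts, so closure of [K] passes to the fuzzy vectors supported in [K]. If [x]
    and [- x] are both supported in [K], every point [u] of the support of [x]
    satisfies [u \in K] and [- u \in K], so that the support is [{0}] and [x] is
    the crisp zero. *)

Require Import Defs.
From mathcomp Require Import all_boot all_order all_algebra.
From mathcomp Require Import boolp classical_sets reals.
From mathcomp Require Import topology numfun.
Import Order.TTheory GRing.Theory Num.Theory.
Local Open Scope classical_set_scope.
Local Open Scope ring_scope.

Lemma supp_fuzzy_add (R : realType) (d : nat) (x y : fuzzy_vector R d) :
  supp (fuzzy_add x y) = [set u + v | u in supp x & v in supp y].
Proof. by rewrite -!cut0 cut_fuzzy_add// lexx ler01. Qed.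

Lemma supp_fuzzy_scale (R : realType) (d : nat) (l : R) (x : fuzzy_vector R d) :
  supp (fuzzy_scale l x) = [set l *: u | u in supp x].
Proof. by rewrite -!cut0 cut_fuzzy_scale// lexx ler01. Qed.

(** Points of positive value lie in the support, so [x] vanishes off the origin. The 1-cut is
    non-empty and consists of such points, so it is the origin alone and [x] takes the value 1
    there. *)
Lemma supp_sub0_fuzzy_zero (R : realType) (d : nat) (x : fuzzy_vector R d) :
  supp x `<=` [set 0] -> x = fuzzy_zero.
Proof.
move=> x0; have [x01 _ xP] := charfunP x.
have pos0 v : 0 < x v -> v = 0 by move=> xv; apply: x0; exact: subset_closure.
apply/fuzzy_vector_eq/funext => v; rewrite /= indicE.
have /andP[xv0 xv1] := x01 v.
case: (boolP (v \in _)) => [/set_mem ->|/negP v0].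
  have [[w]] := xP 1 (introT andP (conj ler01 (lexx 1))).
  rewrite cut_gt0// => /= xw _ _.
  have w0 : w = 0 by apply: pos0; exact: lt_le_trans xw.
  have /andP[_ x1] := x01 0.
  by apply/eqP; rewrite eq_le x1 -{1}w0.
apply/eqP; rewrite eq_le xv0 andbT leNgt; apply/negP => /pos0 E.
by apply: v0; apply/mem_set.
Qed.

Theorem lemma4p2 (R : realType) (d : nat) (hd : (1 < d)%N) (K : set 'rV[R]_d)
    (hK : proper_convex_cone +%R *:%R -%R 0 K) :
  proper_convex_cone (@fuzzy_add R d) (@fuzzy_scale R d) (@fuzzy_opp R d)
    fuzzy_zero (fuzzy_supp_in K).
Proof.
have [[KD KZ] Kproper] := hK.
split; first split.
- move=> x y xK yK; rewrite /fuzzy_supp_in /= supp_fuzzy_add.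
  by move=> _ [u xu [v yv <-]]; apply: KD; [exact: xK|exact: yK].
- move=> l x l0 xK; rewrite /fuzzy_supp_in /= supp_fuzzy_scale.
  by move=> _ [u xu <-]; apply: KZ => //; exact: xK.
(* [fuzzy_opp x] unfolds to [fuzzy_scale (-1) x], so its support consists of the points [-1 *: u]
   with [u] in [supp x]. *)
- move=> x xK; rewrite /fuzzy_supp_in /= supp_fuzzy_scale => NxK.
  apply: supp_sub0_fuzzy_zero => u xu; apply: Kproper; first exact: xK.
  by apply: NxK; exists u => //; rewrite scaleN1r.
Qed.
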